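(* The distributive lattice $\mathcal{F}(\Delta)$ is non-matchable, where $\Delta$ is the poset with eleven elements $0$, $1,2,3,4$, and $x_{ij}$ for $1\le i<j\le 4$, whose order is generated by the cover relations $i<0$ for $i=1,2,3,4$ and $x_{ij}<i$, $x_{ij}<j$ for $1\le i<j\le 4$ (so $0$ is the maximum, and each of the six minimal elements $x_{ij}$ lies below exactly the two elements $i,j$ of the middle level).
   Context: For a poset $P$, a filter is a subset $F\subseteq P$ (possibly empty) such that $x\in F$ and $x\le y$ imply $y\in F$; $\mathcal{F}(P)$ is the set of filters ordered by reverse inclusion, which is a finite distributive lattice when $P$ is finite. Let $G$ be a finite plane bipartite graph with a perfect matching, vertices properly colored black and white. A cell is an inner face whose boundary is a cycle. For a perfect matching $M$, an $M$-alternating cycle is proper if, traversing it clockwise, every edge in $M$ goes from its white end to its black end. The $Z$-transformation digraph $\vec{Z}(G)$ has vertex set $\mathcal{M}(G)$ (the perfect matchings of $G$) and an arc $M_1\to M_2$ iff $M_1\oplus M_2$ is the edge set of a cell that is a proper $M_1$-alternating cycle; $M_1\le M_2$ iff there is a directed path from $M_2$ to $M_1$. $G$ is elementary if connected and every edge lies in a perfect matching; $G$ is weakly elementary if for every cycle $C$ with $G-V(C)$ having a perfect matching, $C$ together with its interior forms an elementary subgraph. For plane weakly elementary bipartite $G$, $(\mathcal{M}(G),\le)$ is a finite distributive lattice. A finite distributive lattice $L$ is matchable if $L\cong\mathcal{M}(G)$ for some plane weakly elementary bipartite graph $G$; otherwise non-matchable. *)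

(* Defs.v *)
From HB Require Import structures.
From mathcomp Require Import all_boot all_order.
From Stdlib Require Import Relation_Operators.

Set Implicit Arguments.
Unset Strict Implicit.
Unset Printing Implicit Defensive.

Import Order.TTheory.
Local Open Scope order_scope.

Section FilterType.
Context {disp : Order.disp_t} (P : finPOrderType disp).

Definition is_filter (F : {set P}) : bool :=
  [forall x in F, forall y, (x <= y) ==> (y \in F)].

Record filters := Filter { filter_set :> {set P}; _ : is_filter filter_set }.

HB.instance Definition _ := [isSub for filter_set].
HB.instance Definition _ := [Finite of filters by <:].

Lemma is_filterP (F : {set P}) :
  reflect (forall x y, x \in F -> x <= y -> y \in F) (is_filter F).
Proof.
apply: (iffP forall_inP) => [h x y xF xy | h x xF].
  by have /forallP/(_ y)/implyP/(_ xy) := h x xF.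
by apply/forallP=> y; apply/implyP; apply: h.
Qed.

Lemma filtersP (F : filters) : is_filter F. Proof. exact: (valP F). Qed.

Lemma is_filterU (F G : filters) : is_filter (F :|: G).
Proof.
apply/is_filterP=> x y; rewrite !inE => /orP[] h xy; apply/orP.
  by left; apply: (is_filterP _ (filtersP F)) xy.
by right; apply: (is_filterP _ (filtersP G)) xy.
Qed.

Lemma is_filterI (F G : filters) : is_filter (F :&: G).
Proof.
apply/is_filterP=> x y; rewrite !inE => /andP[h k] xy; apply/andP; split.
  by apply: (is_filterP _ (filtersP F)) xy.
by apply: (is_filterP _ (filtersP G)) xy.
Qed.

(* Reverse inclusion, so that meet is union and join is intersection. *)
Definition filter_le (F G : filters) : bool := G \subset (F : {set P}).
Definition filter_meet (F G : filters) : filters := Filter (is_filterU F G).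
Definition filter_join (F G : filters) : filters := Filter (is_filterI F G).

Lemma filter_le_refl : reflexive filter_le.
Proof. by move=> F; apply: subxx. Qed.

Lemma filter_le_anti : antisymmetric filter_le.
Proof. by move=> F G /andP[h k]; apply/val_inj/eqP; rewrite eqEsubset; apply/andP. Qed.

Lemma filter_le_trans : transitive filter_le.
Proof. by move=> G F H h k; apply: subset_trans k h. Qed.

Fact filter_display : Order.disp_t. Proof. exact: Order.Disp tt tt. Qed.

HB.instance Definition _ := Order.Le_isPOrder.Build filter_display filters
  filter_le_refl filter_le_anti filter_le_trans.

Lemma filter_lexI (F G H : filters) :
  (F <= filter_meet G H) = (F <= G) && (F <= H).
Proof. by rewrite /Order.le /= /filter_le subUset. Qed.

Lemma filter_leUx (F G H : filters) :
  (filter_join F G <= H) = (F <= H) && (G <= H).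
Proof. by rewrite /Order.le /= /filter_le subsetI. Qed.

HB.instance Definition _ := Order.POrder_MeetJoin_isLattice.Build
  filter_display filters filter_lexI filter_leUx.

Lemma filter_meetUl :
  left_distributive (@Order.meet _ filters) (@Order.join _ filters).
Proof. by move=> F G H; apply/val_inj; apply: setUIl. Qed.

HB.instance Definition _ := Order.Lattice_Meet_isDistrLattice.Build
  filter_display filters filter_meetUl.

End FilterType.

(* A finite plane bipartite (multi)graph without isolated vertices, possibly   *)
(* disconnected, given by its combinatorial embedding.                         *)
(* Every edge consists of two opposite darts d and opp d, the dart d going     *)
(* from src d to src (opp d).  The darts leaving a vertex are cyclically       *)
(* ordered counterclockwise by ccw.  The face on the right of d is rface d;    *)
(* walking with that face on the right, d is followed by ccw (opp d).          *)
(* When the graph is disconnected a face may have several boundary walks, so   *)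
(* rface is part of the data.  The surface obtained by gluing the faces is the *)
(* sphere exactly when it is connected and satisfies Euler's formula           *)
(* v - e + f = 1 + c, c being the number of components of the graph; choosing  *)
(* the outer face makes it the plane.  There being no isolated vertex is       *)
(* harmless, as only graphs with a perfect matching are considered.  So are    *)
(* parallel edges: replacing an edge by a path of length three changes neither *)
(* the matchings nor the cells nor weak elementarity.                          *)
Record plane_bigraph := PlaneBigraph {
  vertex : finType;
  dart : finType;
  face : finType;
  src : dart -> vertex;
  opp : dart -> dart;
  ccw : dart -> dart;
  rface : dart -> face;
  outer : face;
  white : vertex -> bool;
  oppK : involutive opp;
  opp_neq : forall d, opp d != d;
  white_opp : forall d, white (src (opp d)) = ~~ white (src d);
  src_surj : forall v, exists d, src d = v;
  ccw_inj : injective ccw;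
  ccw_src : forall d d', fconnect ccw d d' = (src d == src d');
  rface_surj : forall f, exists d, rface d = f;
  rface_ccw : forall d, rface (ccw (opp d)) = rface d;
  sphere_connected : forall f g,
    connect [rel f1 f2 | [exists d, (rface d == f1) && (rface (opp d) == f2)]]
      f g;
  euler : (#|vertex| + #|face| = #|dart|./2 + 1 +
    n_comp [rel u v | [exists d, (src d == u) && (src (opp d) == v)]] vertex)%N
}.

Arguments outer : clear implicits.

Section Matchings.
Variable G : plane_bigraph.
Implicit Types (U : {set vertex G}) (S M : {set dart G}) (p : seq (dart G)).

Definition dst (d : dart G) : vertex G := src (opp d).

(* Edge sets are represented by sets of darts stable under opp, and a subgraph *)
(* by its vertex set U together with its edge set S.                           *)
Definition perfect_matching U S M : bool :=
  [&& M \subset S,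
      [forall d in M, opp d \in M] &
      [forall v in U, #|[set d in M | src d == v]| == 1%N]].

Definition connected U S : Prop :=
  forall u v, u \in U -> v \in U ->
    connect [rel x y | [exists d in S, (src d == x) && (dst d == y)]] u v.

Definition elementary U S : Prop :=
  connected U S /\
  forall d, d \in S -> exists2 M, perfect_matching U S M & d \in M.

(* A cycle together with a direction of traversal. *)
Definition is_cycle p : bool :=
  [&& p != [::], cycle [rel d d' | dst d == src d'] p, uniq (map (@src G) p) &
      all (fun d => opp d \notin p) p].

Definition cycle_vertices p : {set vertex G} := [set v in map (@src G) p].

Definition cycle_edges p : {set dart G} :=
  [set d | (d \in p) || (opp d \in p)].

(* A face is inside the cycle when it cannot be joined to the outer face by    *)
(* crossing edges that are not on the cycle.                                   *)
Definition inside p (f : face G) : bool :=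
  ~~ connect
       [rel f1 f2 | [exists d, [&& d \notin cycle_edges p,
                                  rface d == f1 & rface (opp d) == f2]]]
       (outer G) f.

Definition disc_edges p : {set dart G} :=
  cycle_edges p :|: [set d | inside p (rface d)].

Definition disc_vertices p : {set vertex G} :=
  [set src d | d in disc_edges p].

Definition avoiding_edges p : {set dart G} :=
  [set d | (src d \notin cycle_vertices p) && (dst d \notin cycle_vertices p)].

Definition weakly_elementary : Prop :=
  forall p, is_cycle p ->
    (exists M, perfect_matching (~: cycle_vertices p) (avoiding_edges p) M) ->
    elementary (disc_vertices p) (disc_edges p).

Definition face_boundary (f : face G) : {set dart G} :=
  [set d | (rface d == f) || (rface (opp d) == f)].

Definition cell_cycle p : Prop :=
  is_cycle p /\ exists2 f, f != outer G & face_boundary f = cycle_edges p.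

(* A clockwise traversal has the interior on its right. *)
Definition clockwise p : bool := all (fun d => inside p (rface d)) p.

Definition alternating M p : bool :=
  cycle [rel d d' | (d \in M) != (d' \in M)] p.

(* For a clockwise p: each matching edge runs from white to black. *)
Definition proper_cycle M p : bool := all (fun d => (d \in M) ==> white (src d)) p.

Definition matching := {M : {set dart G} | perfect_matching setT setT M}.

Definition Z_arc (M1 M2 : matching) : Prop :=
  exists p, [/\ cell_cycle p, clockwise p, alternating (val M1) p,
    proper_cycle (val M1) p &
    (val M1 :\: val M2) :|: (val M2 :\: val M1) = cycle_edges p].

Definition matching_le (M1 M2 : matching) : Prop :=
  clos_refl_trans _ Z_arc M2 M1.

End Matchings.

Definition matchable (disp : Order.disp_t) (L : finDistrLatticeType disp) :
    Prop :=
  exists G : plane_bigraph,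
    [/\ exists M : {set dart G}, perfect_matching setT setT M,
        weakly_elementary G &
        exists2 phi : L -> matching G, bijective phi &
          forall x y, x <= y <-> matching_le (phi x) (phi y)].

(* The indices 1, ..., 4 are represented by the four elements of 'I_4. *)
Inductive Delta :=
  | D0
  | Di of 'I_4
  | Dx of {ij : 'I_4 * 'I_4 | (ij.1 < ij.2)%N}.

Definition Delta_code (a : Delta) :
    option ('I_4 + {ij : 'I_4 * 'I_4 | (ij.1 < ij.2)%N}) :=
  match a with D0 => None | Di i => Some (inl i) | Dx x => Some (inr x) end.

Definition Delta_decode
    (c : option ('I_4 + {ij : 'I_4 * 'I_4 | (ij.1 < ij.2)%N})) : Delta :=
  match c with
  | None => D0 | Some (inl i) => Di i | Some (inr x) => Dx x
  end.

Lemma Delta_codeK : cancel Delta_code Delta_decode. Proof. by case. Qed.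

HB.instance Definition _ := Equality.copy Delta (can_type Delta_codeK).
HB.instance Definition _ := Choice.copy Delta (can_type Delta_codeK).
HB.instance Definition _ := Countable.copy Delta (can_type Delta_codeK).
HB.instance Definition _ := Finite.copy Delta (can_type Delta_codeK).

Definition Delta_cover : rel Delta := fun a b =>
  match a, b with
  | Di _, D0 => true
  | Dx x, Di i => (i == (val x).1) || (i == (val x).2)
  | _, _ => false
  end.

Definition Delta_le : rel Delta := connect Delta_cover.

Definition Delta_rank (a : Delta) : nat :=
  match a with D0 => 2 | Di _ => 1 | Dx _ => 0 end.

Lemma Delta_le_rank a b : Delta_le a b -> a = b \/ (Delta_rank a < Delta_rank b)%N.
Proof.
case/connectP=> s; elim: s a => [|c s IHs] a /=; first by move=> _ ->; left.
case/andP=> ac cs eb; right.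
have ltac : (Delta_rank a < Delta_rank c)%N by case: a c ac {cs eb} => [|i|x] [|j|y].
by case: (IHs c cs eb) => [<- // | ltcb]; apply: ltn_trans ltcb.
Qed.

Lemma Delta_le_refl : reflexive Delta_le. Proof. exact: connect0. Qed.

Lemma Delta_le_anti : antisymmetric Delta_le.
Proof.
move=> a b /andP[/Delta_le_rank[//|ab] /Delta_le_rank[//|ba]].
by have := ltn_trans ab ba; rewrite ltnn.
Qed.

Lemma Delta_le_trans : transitive Delta_le. Proof. exact: connect_trans. Qed.

Fact Delta_display : Order.disp_t. Proof. exact: Order.Disp tt tt. Qed.

HB.instance Definition _ := Order.Le_isPOrder.Build Delta_display Delta
  Delta_le_refl Delta_le_anti Delta_le_trans.

(* Main.v *)
Require Import Defs.
From mathcomp Require Import all_boot all_order all_algebra.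
From mathcomp Require Import zify.
From Stdlib Require Import Relation_Operators Operators_Properties.

(** In the matching lattice every covering pair is the rotation of one cell.
    Rotating a cell changes the matching by a coboundary of its indicator
    function, so the cells rotated along a path depend only on its ends, and
    each element of the poset gets a cell of its own.  Incomparable elements
    have distinct cells, while an element and one covering it have distinct
    cells sharing an edge.  In Delta the cell of 0 cannot be that of x_ij
    either: all its edges would be flipped in between by the cells of i and j,
    but one of them is shared with the cell of a third k.  So the dual graph
    contains a subdivision of K5 with branch vertices 0, 1, 2, 3, 4.

    This contradicts Euler's formula, which says that an edge set meeting every
    face evenly is a vertex cut.  Apply this to the six triangles 0ij: the
    resulting map from the vertices to F_2^6 has level sets whose boundaries
    are even subgraphs of K5, so the nonempty ones have at least three edges,
    and each edge lies in two of them; at most 20 / 3 < 7 levels are involved.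
    But the levels affinely span F_2^6, so there are at least seven. *)

Set Implicit Arguments.
Unset Strict Implicit.
Unset Printing Implicit Defensive.

Import Order.TTheory GRing.Theory.
Import Defs.

(** * Incidence matrices and planar duality *)

Section Incidence.
Variables (T E : finType) (s t : E -> T).
Local Open Scope ring_scope.

(** Over F_2 a loop gives a zero column, as it should for an edge with the same face on both
    sides. *)
Definition incidence : 'M['F_2]_(#|T|, #|E|) :=
  \matrix_(i, j) ((s (enum_val j) == enum_val i)%:R
                  + (t (enum_val j) == enum_val i)%:R).

Lemma sum_delta_F2 (I : finType) (u : I -> 'F_2) (x : I) :
  \sum_i u i * (x == i)%:R = u x.
Proof.
rewrite (bigD1 x) //= eqxx mulr1 big1 ?addr0 // => i /negPf.
by rewrite eq_sym => ->; rewrite mulr0.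
Qed.

Lemma mulmx_incidenceE (u : 'rV['F_2]_#|T|) e :
  (u *m incidence) 0 (enum_rank e) =
  u 0 (enum_rank (s e)) + u 0 (enum_rank (t e)).
Proof.
rewrite mxE.
under eq_bigr => i _ do rewrite mxE enum_rankK mulrDr.
rewrite big_split /= -!(sum_delta_F2 (u 0)).
congr (_ + _); apply: eq_bigr => i _; congr (_ * _%:R);
  by rewrite -(inj_eq enum_val_inj) enum_rankK.
Qed.

Lemma addF2_eq0 (a b : 'F_2) : (a + b == 0) = (a == b).
Proof. by rewrite addr_eq0; have -> : - b = b by apply/val_inj; case: b => [[|[|]]]. Qed.

(** A function in the left kernel is constant on the components of [r], so the dimension of the
    kernel is at most their number. *)
Lemma rank_incidence (r : rel T) : connect_sym r ->
    (forall x y, r x y -> exists e, s e = x /\ t e = y \/ s e = y /\ t e = x) ->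
  (#|T| <= \rank incidence + n_comp r T)%N.
Proof.
move=> symr hr; rewrite -leq_subLR -mxrank_ker.
pose rts := [predI roots r & T].
(* The rows of [K] are the indicator functions of the components. *)
pose K : 'M['F_2]_(#|rts|, #|T|) :=
  \matrix_(k, i) (fingraph.root r (enum_val i) == enum_val k)%:R.
apply: leq_trans (rank_leq_row K); apply: mxrankS.
apply/row_subP => i; set u := row i _.
have uA : u *m incidence = 0.
  by apply/sub_kermxP; apply: row_sub.
have ue e : u 0 (enum_rank (s e)) = u 0 (enum_rank (t e)).
  by apply/eqP; rewrite -addF2_eq0 -mulmx_incidenceE uA mxE.
have ur x y : r x y -> u 0 (enum_rank x) = u 0 (enum_rank y).
  by case/hr=> e [] [<- <-].
have uc x y : connect r x y -> u 0 (enum_rank x) = u 0 (enum_rank y).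
  case/connectP=> q; elim: q x => [|z q IH] x /=; first by move=> _ ->.
  by case/andP=> /ur -> /IH h /h.
have -> : u = (\row_k u 0 (enum_rank (enum_val k))) *m K; last exact: submxMl.
apply/rowP => j; rewrite [RHS]mxE.
have rj : fingraph.root r (enum_val j) \in rts by rewrite !inE /= roots_root.
rewrite (bigD1 (enum_rank_in rj (fingraph.root r (enum_val j)))) //= big1 => [|k].
  rewrite [K _ _]mxE [(\row_k _) _ _]mxE enum_rankK_in // eqxx mulr1 addr0.
  by rewrite -(uc _ _ (connect_root r _)) enum_valK.
rewrite [K _ _]mxE; case: (_ =P enum_val k) => [rk /eqP[]|_ _]; last by rewrite mulr0.
by apply: enum_val_inj; rewrite enum_rankK_in.
Qed.
End Incidence.

(** * Even edge sets and vertex cuts of a plane graph *)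

Section Duality.
Variable G : plane_bigraph.
Local Open Scope ring_scope.

(** Exactly one dart of each edge leaves a white vertex, so these darts enumerate the edges. *)
Definition white_dart : finType := {d : dart G | white (src d)}.

Lemma sum_white_dart (R : nmodType) (g : dart G -> R) :
  \sum_(e : white_dart) (g (val e) + g (opp (val e))) = \sum_d g d.
Proof.
rewrite big_split /= [RHS](bigID (fun d => white (src d))) /=.
rewrite -(big_sub [pred d | white (src d)]).
rewrite -(big_sub [pred d | white (src d)] (g \o opp (p:=G))).
congr (_ + _); rewrite [RHS](reindex_inj (inv_inj (@oppK G))) /=.
by apply: eq_bigl => d; rewrite inE white_opp negbK.
Qed.

Lemma card_white_dart : #|white_dart| = #|dart G|./2.
Proof.
have := sum_white_dart (fun=> 1%N); rewrite !sum_nat_const /= muln1 => <-.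
by rewrite muln2 doubleK.
Qed.

Lemma adj_sym (T : finType) (h : dart G -> T) :
  connect_sym [rel u v | [exists d, (h d == u) && (h (opp d) == v)]].
Proof.
apply: sym_connect_sym => u v /=; apply/existsP/existsP=> -[d /andP[a b]];
  by exists (opp d); rewrite oppK b a.
Qed.

Lemma adj_edge (T : finType) (h : dart G -> T) (u v : T) :
    [exists d, (h d == u) && (h (opp d) == v)] ->
  exists e : white_dart, h (val e) = u /\ h (opp (val e)) = v
                      \/ h (val e) = v /\ h (opp (val e)) = u.
Proof.
case/existsP=> d /andP[/eqP<- /eqP<-].
case: (boolP (white (src d))) => wd; first by exists (exist _ d wd); left.
have wo : white (src (opp d)) by rewrite white_opp.
by exists (exist _ (opp d) wo); right; rewrite /= oppK.
Qed.

Definition vertex_mx :=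
  incidence (fun e : white_dart => src (val e)) (fun e => src (opp (val e))).
Definition face_mx :=
  incidence (fun e : white_dart => rface (val e)) (fun e => rface (opp (val e))).

(** The permutation sending [d] to [ccw (opp d)] preserves the face, and the image of [d] starts
    where [d] ends. *)
Lemma sum_face_ccw (f : face G) (R : nmodType) (g : vertex G -> R) :
  \sum_(d | rface d == f) g (src (opp d)) = \sum_(d | rface d == f) g (src d).
Proof.
have inj : injective (fun d : dart G => ccw (opp d)).
  exact: inj_comp (@ccw_inj G) (inv_inj (@oppK G)).
rewrite [RHS](reindex_inj inj) /=; apply: eq_big => [d|d _]; first by rewrite rface_ccw.
by congr (g _); apply/eqP; rewrite -ccw_src fconnect1.
Qed.

Lemma cut_face_even (f : face G) (g : vertex G -> 'F_2) :
  \sum_(d | rface d == f) (g (src d) + g (src (opp d))) = 0.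
Proof. by rewrite big_split /= sum_face_ccw; apply/eqP; rewrite addF2_eq0. Qed.

Lemma mulmx_face_mxE (z : dart G -> 'F_2) : (forall d, z (opp d) = z d) ->
  forall f, ((\row_(j < #|white_dart|) z (val (enum_val j))) *m face_mx^T) 0 (enum_rank f)
     = \sum_(d | rface d == f) z d.
Proof.
move=> zo f; rewrite mxE [RHS]big_mkcond /= -sum_white_dart.
rewrite (reindex_onto (@enum_rank white_dart) enum_val) => [|i _]; last exact: enum_valK.
rewrite (eq_bigl xpredT) => [|e]; last by rewrite enum_rankK eqxx.
apply: eq_bigr => e _; rewrite !mxE !enum_rankK zo mulrDr.
by do 2!case: eqP => _; rewrite ?mulr1 ?mulr0.
Qed.

(* Cellular homology mod 2: Euler's formula gives vertex_mx and face_mx        *)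
(* complementary ranks, so the coboundary sequence is exact in the middle.     *)
Lemma cycle_is_cut (z : dart G -> 'F_2) :
    (forall d, z (opp d) = z d) ->
    (forall f, \sum_(d | rface d == f) z d = 0) ->
  exists s : vertex G -> 'F_2, forall d, s (src d) + s (src (opp d)) = z d.
Proof.
move=> zo z0.
have rV := rank_incidence (adj_sym (@src G)) (@adj_edge _ (@src G)).
have rF := rank_incidence (adj_sym (@rface G)) (@adj_edge _ (@rface G)).
have nF : n_comp [rel f g | [exists d, (@rface G d == f) && (rface (opp d) == g)]]
    (face G) = 1%N.
  rewrite -(n_comp_connect (adj_sym (@rface G)) (outer G)).
  by apply: eq_n_comp_r => f; rewrite !inE sphere_connected.
(* The star of a vertex meets every face evenly. *)
have VF0 : (vertex_mx <= kermx face_mx^T)%MS.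
  apply/sub_kermxP/row_matrixP => i; rewrite row0 row_mul.
  pose z' (d : dart G) : 'F_2 :=
    (src d == enum_val i)%:R + (src (opp d) == enum_val i)%:R.
  have -> : row i vertex_mx = \row_(j < #|white_dart|) z' (val (enum_val j)).
    by apply/rowP => j; rewrite !mxE.
  apply/rowP => k; rewrite -(enum_valK k) mulmx_face_mxE ?[RHS]mxE => [|d].
    exact: cut_face_even (fun v => (v == enum_val i)%:R).
  by rewrite /z' oppK addrC.
(* The two rank bounds and Euler's formula leave no room for a strict inclusion. *)
have VF : (vertex_mx == kermx face_mx^T)%MS.
  rewrite -(mxrank_leqif_eq VF0) eqn_leq mxrankS //= mxrank_ker mxrank_tr.
  have arith (v f e c a b : nat) : (v <= a + c -> f <= b + 1 -> v + f = e + 1 + c ->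
    e - b <= a)%N by lia.
  rewrite nF in rF; apply: arith rV rF _.
  by rewrite card_white_dart; exact: euler.
have /submxP[u zu] : (\row_(j < #|white_dart|) z (val (enum_val j)) <= vertex_mx)%MS.
  rewrite (eqmxP VF); apply/sub_kermxP/rowP => k.
  by rewrite -(enum_valK k) mulmx_face_mxE // z0 mxE.
have ze e : u 0 (enum_rank (src (val e))) + u 0 (enum_rank (src (opp (val e))))
    = z (val (e : white_dart)).
  have := mulmx_incidenceE (fun e : white_dart => src (val e))
    (fun e => src (opp (val e))) u e.
  by rewrite -/vertex_mx -zu mxE enum_rankK => ->.
exists (fun v => u 0 (enum_rank v)) => d.
case: (boolP (white (src d))) => wd; first exact: (ze (exist _ d wd)).
have wo : white (src (opp d)) by rewrite white_opp.
by have := ze (exist _ (opp d) wo); rewrite /= oppK zo addrC.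
Qed.

End Duality.

(** * Nonplanarity of K5 *)

Notation pair4 := {ij : 'I_4 * 'I_4 | (ij.1 < ij.2)%N}.
Definition in_pair (x : pair4) : pred 'I_4 :=
  fun i => (i == (val x).1) || (i == (val x).2).

Section AffineSpan.
Local Open Scope ring_scope.

(** The differences with a base point [h a0] span the whole space, and [a0] itself contributes
    nothing. *)
Lemma card_affine_span (F : fieldType) (n : nat) (T : finType) (h : T -> 'rV[F]_n.+1) :
    (forall i, exists a b, h a - h b = delta_mx 0 i) ->
  (n.+1 < #|T|)%N.
Proof.
move=> hT; have [a0 _] := hT ord0.
pose X := [seq h a - h a0 | a <- enum (predC1 a0)].
have hX a : h a - h a0 \in <<X>>%VS.
  have [->|na] := eqVneq a a0; first by rewrite subrr mem0v.
  by apply/memv_span/map_f; rewrite mem_enum.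
have sX : (fullv <= <<X>>)%VS.
  apply/subvP => v _; rewrite (row_sum_delta v); apply: memv_suml => i _.
  apply: memvZ; have [a [b <-]] := hT i.
  by rewrite -[h a - _](subrKA (h a0)) -[h a0 - h b]opprB rpredB.
have := leq_trans (dimvS sX) (dim_span X).
rewrite dimvf dim_matrix size_map -cardE => le.
have {}le : (n.+1 <= #|predC1 a0|)%N by rewrite -[n.+1]mul1n.
by rewrite -(cardC (pred1 a0)) card1 add1n ltnS.
Qed.
End AffineSpan.

Section Pairs.

(** Turns sums over pairs into double sums that unfold to explicit terms. *)
Lemma big_pair4 (R : Type) (idx : R) (op : Monoid.com_law idx)
    (F : pair4 -> R) (P : pred ('I_4 * 'I_4)) :
  \big[op/idx]_(x : pair4 | P (val x)) F x =
  \big[op/idx]_(i < 4) \big[op/idx]_(j < 4)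
     if (i < j) && P (i, j) then oapp F idx (insub (i, j)) else idx.
Proof.
pose A := [pred ij : 'I_4 * 'I_4 | ij.1 < ij.2].
under [RHS]eq_bigr => i _ do rewrite -big_mkcond.
rewrite pair_big_dep /= (eq_bigl (fun p => (p \in A) && P p)); last by case.
rewrite (eq_bigr (fun p => oapp F idx (insub p))) => [|[]//].
by rewrite big_sub_cond; apply: eq_bigr => x _; rewrite valK.
Qed.

Lemma card_pair4 : #|{: pair4}| = 6.
Proof.
rewrite -sum1_card (big_pair4 _ _ xpredT).
by rewrite !big_ord_recl !big_ord0 /= !insubT.
Qed.

(* [g] is the restriction of an even subgraph of K5 to the K4 avoiding the     *)
(* apex; evenness determines the edges at the apex, counted by the first sum.  *)
Lemma even_K5_ge3 (g : pair4 -> 'F_2) : (exists x, g x != 0%R) ->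
  3 <= \sum_(i < 4) (\sum_(x | in_pair x i) g x != 0)%R + \sum_x (g x != 0%R).
Proof.
have neF (a : 'F_2) : {b : bool | a = b%:R%R}.
  by exists (a != 0%R); apply/val_inj; case: a => [[|[|]]].
case=> x0 gx0.
have : \sum_x (g x != 0%R) != 0 by rewrite (bigD1 x0) //= gx0.
under [X in _ <= X + _]eq_bigr => i _ do
  rewrite (big_pair4 _ _ (fun p => (i == p.1) || (i == p.2))).
rewrite (big_pair4 _ _ xpredT) !big_ord_recl !big_ord0 /= !insubT /=.
(* Only six values in F_2 remain, and all 64 cases are evaluated. *)
clear gx0; repeat match goal with |- context [g ?x] =>
  move: (g x) => a; case: (neF a) => -[] -> {a} end; by vm_compute.
Qed.
End Pairs.

(** * A subdivided K5 in the dual graph *)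

Section NonPlanar.
Variables (G : plane_bigraph) (lab : Delta -> face G) (D : Delta -> Delta -> dart G).
Hypothesis lab_inj : injective lab.
Hypothesis rfaceD : forall a b, Delta_cover a b -> rface (D a b) = lab a.
Hypothesis rface_oppD : forall a b, Delta_cover a b -> rface (opp (D a b)) = lab b.
Local Open Scope ring_scope.

Let edge a b (d : dart G) : 'F_2 := (d == D a b)%:R + (d == opp (D a b))%:R.

Let edge_opp a b d : edge a b (opp d) = edge a b d.
Proof. by rewrite /edge (inv_eq (@oppK G)) (inj_eq (inv_inj (@oppK G))) addrC. Qed.

Let edge_D a b a' b' : Delta_cover a b -> Delta_cover a' b' ->
  edge a b (D a' b') = ((a == a') && (b == b'))%:R.
Proof.
move=> ab ab'; rewrite /edge.
(* Such an equality would make [a], [b] a covering pair in both directions. *)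
have -> : (D a' b' == opp (D a b)) = false.
  apply/eqP => e; have ea := rfaceD ab'; have eb := rface_oppD ab'.
  move: ea eb; rewrite e oppK rfaceD ?rface_oppD // => /lab_inj e1 /lab_inj e2.
  by move: ab ab'; rewrite -e1 -e2; case: (a) (b) => [|i|x] [|j|y].
rewrite addr0; congr (_%:R); congr nat_of_bool; apply/eqP/andP => [e|[/eqP-> /eqP->]//].
split; apply/eqP; apply: lab_inj; first by rewrite -(rfaceD ab) -(rfaceD ab') e.
by rewrite -(rface_oppD ab) -(rface_oppD ab') e.
Qed.

Let sum_edge a b (f : face G) : Delta_cover a b ->
  \sum_(d | rface d == f) edge a b d = (lab a == f)%:R + (lab b == f)%:R.
Proof.
move=> ab; rewrite big_mkcond /=.
rewrite (eq_bigr (fun d => (rface d == f)%:R * (D a b == d)%:R +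
   (rface d == f)%:R * (opp (D a b) == d)%:R)) => [|d _].
  rewrite big_split /= !(sum_delta_F2 (fun d => (rface d == f)%:R)).
  by rewrite rfaceD // rface_oppD.
by rewrite /edge ![_ == d]eq_sym -mulrDr; case: eqP; rewrite ?mul1r ?mul0r.
Qed.

Let i1 (x : pair4) := (val x).1.
Let i2 (x : pair4) := (val x).2.

Let cover1 x : Delta_cover (Dx x) (Di (i1 x)). Proof. by rewrite /= eqxx. Qed.
Let cover2 x : Delta_cover (Dx x) (Di (i2 x)). Proof. by rewrite /= eqxx orbT. Qed.

Let ne12 x : i2 x != i1 x.
Proof. by case: x => -[i j] ij; rewrite -val_eqE neq_ltn ij orbT. Qed.

(** The closed dual walk through x_ij, i, 0 and j: the triangle 0ij of K5 with its side ij
    subdivided by x_ij. *)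
Let triangle x d : 'F_2 := edge (Dx x) (Di (i1 x)) d + edge (Dx x) (Di (i2 x)) d
  + (edge (Di (i1 x)) D0 d + edge (Di (i2 x)) D0 d).

Let addF2 (a : 'F_2) : a + a = 0.
Proof. by apply/eqP; rewrite addF2_eq0. Qed.

Let oppF2 (a : 'F_2) : - a = a.
Proof. by apply/eqP; rewrite eq_sym -addr_eq0 addF2. Qed.

Let triangle_even x f : \sum_(d | rface d == f) triangle x d = 0.
Proof.
rewrite /triangle big_split /= [X in X + _]big_split /= [X in _ + X]big_split /=.
rewrite !sum_edge ?cover1 ?cover2 //.
by do 4!case: (lab _ == f); apply/val_inj.
Qed.

Lemma no_K5_in_dual : False.
Proof.
have [s hs] : exists s : pair4 -> vertex G -> 'F_2,
    forall x d, s x (src d) + s x (src (opp d)) = triangle x d.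
  apply: (@fin_all_exists _ _ (fun x s => forall d,
    s (src d) + s (src (opp d)) = triangle x d)) => x; apply: cycle_is_cut => [d|f].
    by rewrite /triangle !edge_opp.
  exact: triangle_even.
(* Each triangle is the cut of some [s x]; together these place every vertex at a level in F_2^6,
   and [cut w] is the boundary of level [w]. *)
pose S v : {ffun pair4 -> 'F_2} := [ffun x => s x v].
pose cut w d : 'F_2 := (S (src d) == w)%:R + (S (src (opp d)) == w)%:R.
have cut_opp w d : cut w (opp d) = cut w d by rewrite /cut oppK addrC.
have cut_even w f : \sum_(d | rface d == f) cut w d = 0.
  exact: cut_face_even (fun v => (S v == w)%:R).
(* An edge that was not chosen lies on no triangle, so its ends are at the same level and it lies in
   no cut. *)
have cutE w d : cut w d = \sum_(p : Delta * Delta | Delta_cover p.1 p.2)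
    edge p.1 p.2 d * cut w (D p.1 p.2).
  have [p /andP[cp dp]|nop] := pickP [pred p : Delta * Delta |
      Delta_cover p.1 p.2 & (d == D p.1 p.2) || (d == opp (D p.1 p.2))].
    have edge_d a b : edge a b d = edge a b (D p.1 p.2).
      by case/orP: dp => /eqP ->; rewrite ?edge_opp.
    have -> : cut w d = cut w (D p.1 p.2).
      by case/orP: dp => /eqP ->; rewrite ?cut_opp.
    rewrite (bigD1 p) //= edge_d edge_D // !eqxx mul1r big1 ?addr0 // => q /andP[cq nq].
    by rewrite edge_d edge_D // -[_ && _]/(q == p) (negPf nq) mul0r.
  have edge0 a b : Delta_cover a b -> edge a b d = 0.
    move=> ab; have := nop (a, b); rewrite /= ab /= => /norP[].
    by rewrite /edge => /negPf-> /negPf->; rewrite addr0.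
  rewrite big1 => [|p cp]; last by rewrite edge0 ?mul0r.
  rewrite /cut; have -> : S (src d) = S (src (opp d)); last exact: addF2.
  apply/ffunP => x; rewrite !ffunE; apply/eqP; rewrite -addF2_eq0 hs /triangle.
  by rewrite !edge0 ?addr0.
(* Evenness of the cut around the face [lab g] is evenness of the degree at the node [g] of the
   subdivided K5. *)
have degree w g : \sum_(b | Delta_cover g b) cut w (D g b)
    + \sum_(a | Delta_cover a g) cut w (D a g) = 0.
  rewrite -[RHS](cut_even w (lab g)).
  under [RHS]eq_bigr => d _ do rewrite cutE.
  rewrite exchange_big /=.
  rewrite [RHS](eq_bigr (fun p => (p.1 == g)%:R * cut w (D p.1 p.2)
      + (p.2 == g)%:R * cut w (D p.1 p.2))) => [|p cp]; last first.
    by rewrite -mulr_suml sum_edge // !(inj_eq lab_inj) mulrDl.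
  rewrite [RHS]big_split /=; congr (_ + _).
    rewrite [RHS](eq_bigr (fun p => if p.1 == g then cut w (D p.1 p.2) else 0)); last first.
      by move=> p _; case: eqP; rewrite ?mul1r ?mul0r.
    rewrite -big_mkcondr [RHS](reindex_omap (fun b => (g, b))
      (fun p => if p.1 == g then Some p.2 else None)) /=.
      by apply: eq_bigl => b; rewrite !eqxx !andbT.
    by case=> a b /= /andP[_ /eqP->]; rewrite eqxx.
  rewrite [RHS](eq_bigr (fun p => if p.2 == g then cut w (D p.1 p.2) else 0)); last first.
    by move=> p _; case: eqP; rewrite ?mul1r ?mul0r.
  rewrite -big_mkcondr [RHS](reindex_omap (fun a => (a, g))
    (fun p => if p.2 == g then Some p.1 else None)) /=.
    by apply: eq_bigl => b; rewrite !eqxx !andbT.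
  by case=> a b /= /andP[_ /eqP->]; rewrite eqxx.
(* A subdividing node has degree two, so the two halves of a side ij agree. *)
have cut_x w x : cut w (D (Dx x) (Di (i1 x))) = cut w (D (Dx x) (Di (i2 x))).
  apply/eqP; rewrite -addF2_eq0; have := degree w (Dx x).
  rewrite [X in _ + X]big_pred0 ?addr0; last by case.
  rewrite (bigD1 (Di (i1 x))) ?cover1 //= (bigD1 (Di (i2 x))) /=; last first.
    by rewrite eqxx orbT -[_ == _]/(i2 x == i1 x) ne12.
  rewrite big_pred0 ?addr0 => [->|[|i|y]] //=.
  rewrite -[_ == Di (i1 x)]/(i == i1 x) -[_ == Di (i2 x)]/(i == i2 x).
  by rewrite -/(i1 x) -/(i2 x); do 2!case: eqP.
have cut_i w i : cut w (D (Di i) D0) =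
    \sum_(x | in_pair x i) cut w (D (Dx x) (Di (i1 x))).
  apply/eqP; rewrite -addF2_eq0; have := degree w (Di i).
  rewrite (big_pred1 D0) => [|[]] //.
  rewrite (reindex_omap Dx (fun a => if a is Dx x then Some x else None)) /=; last by case.
  rewrite (eq_big (in_pair^~ i) (fun x => cut w (D (Dx x) (Di (i1 x))))) => [/eqP //|x|x].
    by rewrite eqxx andbT.
  by rewrite eqxx andbT => /orP[] /eqP ->; rewrite ?cut_x.
(* By [cut_i] and [cut_x], a cut that avoids these six edges is empty. *)
pose pW (w : {ffun pair4 -> 'F_2}) := [exists x, cut w (D (Dx x) (Di (i1 x))) != 0].
pose W := {w | pW w}.
(* Only the triangle 0ij contains the side ij, so crossing that side changes a single coordinate. *)
have cutS x : S (src (D (Dx x) (Di (i1 x)))) - S (src (opp (D (Dx x) (Di (i1 x)))))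
    = [ffun y => (x == y)%:R].
  apply/ffunP => y; rewrite !ffunE oppF2 hs /triangle !edge_D ?cover1 ?cover2 //.
  rewrite -!(eq_sym (Dx x)) -[Dx x == Dx y]/(x == y) !addr0.
  case: (x =P y) => [<-|//]; rewrite eqxx /=.
  by rewrite -[Di _ == _]/(i2 x == i1 x) (negPf (ne12 x)) addr0.
have cut_neq0 w d : (cut w d != 0) = (S (src d) == w) (+) (S (src (opp d)) == w).
  by rewrite /cut; do 2!case: (_ == w).
(* Double counting over the ten edges of K5: at most two levels per edge, at least three edges per
   level. *)
have leW : (#|{: W}| * 3 <= 20)%N.
  have card_cut d : (\sum_(w : W) (cut (val w) d != 0%R) <= 2)%N.
    pose A (v : vertex G) := [set w : W | S v == val w].
    have cardA v : (#|A v| <= 1)%N.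
      apply/card_le1_eqP => w w'; rewrite !inE => /eqP e /eqP e'.
      by apply/val_inj; rewrite /= -e -e'.
    apply: (@leq_trans (#|A (src d)| + #|A (src (opp d))|)); last first.
      by apply: (@leq_trans (1 + 1)%N) => //; apply: leq_add.
    rewrite -!sum1dep_card [X in (_ <= X + _)%N]big_mkcond.
    rewrite [X in (_ <= _ + X)%N]big_mkcond -big_split /=; apply: leq_sum => w _.
    by rewrite cut_neq0; do 2!case: (_ == _).
  have -> : (20 = \sum_(i < 4) 2 + \sum_(x : pair4) 2)%N.
    by rewrite !sum_nat_const card_ord card_pair4.
  apply: (@leq_trans (\sum_(i < 4) \sum_(w : W) (cut (val w) (D (Di i) D0) != 0%R)
     + \sum_(x : pair4) \sum_(w : W) (cut (val w) (D (Dx x) (Di (i1 x))) != 0%R))%N).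
    rewrite [X in (_ <= X + _)%N]exchange_big [X in (_ <= _ + X)%N]exchange_big /=.
    rewrite -big_split -sum_nat_const /=; apply: leq_sum => w _.
    under eq_bigr => i _ do rewrite cut_i.
    by apply: even_K5_ge3; apply/existsP; exact: (valP w).
  by apply: leq_add; apply: leq_sum => k _; apply: card_cut.
(* The ends of a side ij are at levels in [W] that differ by the basis vector of ij. *)
have gtW : (6 < #|{: W}|)%N.
  apply: (@card_affine_span 'F_2 5 W
     (fun w => \row_k val w (enum_val (cast_ord (esym card_pair4) k)))) => k.
  set x := enum_val (cast_ord (esym card_pair4) k).
  have inW v : S (src (D (Dx x) (Di (i1 x)))) = v \/
      S (src (opp (D (Dx x) (Di (i1 x))))) = v -> pW v.
    move=> hv; apply/existsP; exists x; rewrite cut_neq0.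
    have : S (src (D (Dx x) (Di (i1 x)))) != S (src (opp (D (Dx x) (Di (i1 x))))).
      rewrite -subr_eq0 cutS; apply/eqP => /ffunP/(_ x); rewrite !ffunE eqxx.
      by move/eqP; rewrite oner_eq0.
    by case: hv => <-; rewrite eqxx => /negPf; rewrite 1?eq_sym => ->.
  have [a aE] : exists a : W, val a = S (src (D (Dx x) (Di (i1 x)))).
    by exists (exist pW _ (inW _ (or_introl erefl))).
  have [b bE] : exists b : W, val b = S (src (opp (D (Dx x) (Di (i1 x))))).
    by exists (exist pW _ (inW _ (or_intror erefl))).
  exists a, b.
  apply/rowP => j; rewrite !mxE aE bE.
  have := congr1 (fun f : {ffun pair4 -> 'F_2} =>
    f (enum_val (cast_ord (esym card_pair4) j))) (cutS x).
  rewrite !ffunE => ->; congr (nat_of_bool _)%:R.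
  by rewrite /x (inj_eq enum_val_inj) (inj_eq (@cast_ord_inj _ _ _)) eq_sym.
by move: leW gtW; lia.
Qed.
End NonPlanar.

(** * Rotations of cells *)

Lemma connect_exit (T : finType) (e : rel T) (P : pred T) (x y : T) :
  connect e x y -> P x -> ~~ P y -> exists a b, [/\ e a b, P a & ~~ P b].
Proof.
case/connectP=> q; elim: q x => [|z q IH] x /=; first by move=> _ -> ->.
case/andP=> xz zq ey Px nPy; case: (boolP (P z)) => Pz; last by exists x, z.
exact: IH zq ey Pz nPy.
Qed.

Section Arcs.
Variable G : plane_bigraph.
Implicit Types (f g : face G) (d : dart G) (M N : matching G) (p : seq (dart G)).

Lemma matching_opp M d : (opp d \in val M) = (d \in val M).
Proof.
have /and3P[_ /forall_inP oM _] := valP M.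
by apply/idP/idP => h; [rewrite -[d]oppK|]; apply: oM.
Qed.

(** The darts at a vertex form one orbit of [ccw], so a fixed dart is alone there. *)
Lemma ccw_fixed d d' : ccw d = d -> src d = src d' -> d' = d.
Proof.
move=> cd /eqP; rewrite -ccw_src => /connectP[q].
elim: q => [|e q IH] //= /andP[/eqP <-]; rewrite cd; exact: IH.
Qed.

Definition symdiff (T : finType) (A B : {set T}) := (A :\: B) :|: (B :\: A).

Lemma in_symdiff (T : finType) (A B : {set T}) x :
  (x \in symdiff A B) = (x \in A) (+) (x \in B).
Proof. by rewrite !inE; do 2!case: (_ \in _). Qed.

(** * Boundary cycles of cells *)

Section Cycle.
Variable p : seq (dart G).
Hypothesis cp : is_cycle p.

Lemma cycle_uniq : uniq p.
Proof. by case/and4P: cp => _ _ /map_uniq. Qed.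

Lemma cycle_src_inj : {in p &, injective (@src G)}.
Proof.
case/and4P: cp => _ _ up _ d e /(nthP d)[i ip <-] /(nthP d)[j jp <-] sij.
congr nth; apply/eqP; rewrite -(nth_uniq (src d) _ _ up) ?size_map //.
by rewrite !(nth_map d) // sij.
Qed.

Lemma cycle_next_src d : d \in p -> src (next p d) = dst d.
Proof. by case/and4P: cp => _ /next_cycle h _ _ /h /eqP. Qed.

Lemma cycle_dst_inj : {in p &, injective (@dst G)}.
Proof.
move=> d e dp ep de; rewrite -(prev_next cycle_uniq d) -(prev_next cycle_uniq e).
by congr prev; apply: cycle_src_inj; rewrite ?mem_next // !cycle_next_src.
Qed.

Lemma cycle_opp d : d \in p -> opp d \notin p.
Proof. by case/and4P: cp => _ _ _ /allP; apply. Qed.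

Lemma cycle_ind (P : pred (dart G)) : {in p, forall d, P d -> P (next p d)} ->
  {in p &, forall d e, P d -> P e}.
Proof.
move=> h d e dp; rewrite -(fconnect_cycle (cycle_next cycle_uniq) dp).
case/connectP=> q; elim: q d dp => [|c q IH] d dp /=; first by move=> _ ->.
case/andP=> /eqP <- hq eq Pd; apply: IH (hq) _ _ => //; first by rewrite mem_next.
exact: h.
Qed.

Section Cell.
Variable f : face G.
Hypothesis bf : face_boundary f = cycle_edges p.

Lemma cell_edge d : (d \in p) || (opp d \in p) = (rface d == f) || (rface (opp d) == f).
Proof. by move/setP/(_ d): bf; rewrite !inE => ->. Qed.

(** The boundary walk of [f] continues with [ccw (opp d)], whose edge is on the cycle. So this dart
    is the next one or [opp d], and in the latter case the vertex would have degree one. *)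
Lemma cell_next d : d \in p -> rface d = f -> rface (next p d) = f.
Proof.
move=> dp df; set e := ccw (opp d).
have ef : rface e = f by rewrite rface_ccw.
have se : src e = dst d by apply/eqP; rewrite eq_sym -ccw_src fconnect1.
have := cell_edge e; rewrite ef eqxx /= => /orP[ep|op].
  by rewrite (_ : next p d = e) //; apply: cycle_src_inj; rewrite ?mem_next ?cycle_next_src.
have ed : opp e = d by apply: cycle_dst_inj; rewrite // /dst oppK.
have := cycle_opp dp; rewrite -(ccw_fixed (d := opp d) (d' := next p d)) ?mem_next ?dp //.
  by rewrite -/e -ed oppK.
by rewrite cycle_next_src.
Qed.

(** The same argument for a boundary walk running against [p]. *)
Lemma cell_prev d : d \in p -> rface (opp (next p d)) = f -> rface (opp d) = f.
Proof.
move=> dp; set d' := next p d => df; set e := ccw d'.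
have d'p : d' \in p by rewrite mem_next.
have ef : rface e = f by rewrite /e -[d' in ccw d']oppK rface_ccw.
have se : src e = src d' by apply/eqP; rewrite eq_sym -ccw_src fconnect1.
have sd : src d' = dst d by rewrite cycle_next_src.
have := cell_edge e; rewrite ef eqxx /= => /orP[ep|op]; last first.
  have ed : opp e = d by apply: cycle_dst_inj; rewrite // {1}/dst oppK se.
  by rewrite -ed oppK.
have ed : e = d' by apply: cycle_src_inj.
have := cycle_opp dp; rewrite (ccw_fixed (d := d') (d' := opp d)) ?d'p //.
Qed.
End Cell.
End Cycle.

(** The rotation of a cell expressed dart by dart, with no reference to a boundary cycle. *)
Definition rotates f M1 M2 : Prop :=
  [/\ f != outer G, exists d, rface d = f,
      forall d, rface d = f -> (d \in val M1) = white (src d) &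
      forall d, (d \in val M1) (+) (d \in val M2)
                = (rface d == f) (+) (rface (opp d) == f)].

(** A dual path from the outer face to [f] enters the interior through an edge of [p], and the face
    entered must be [f]. This settles one dart, and the claim spreads around the cycle. *)
Lemma cell_clockwise p f d : is_cycle p -> f != outer G ->
    face_boundary f = cycle_edges p -> clockwise p -> d \in p ->
  rface d = f /\ rface (opp d) != f.
Proof.
move=> cp fo bf /allP cw dp.
have inf : inside p f.
  apply/negP=> /(connect_exit (P := predC1 f)) []; rewrite /= ?eqxx // 1?eq_sym //.
  move=> a [b [/existsP[e /and3P[ne _ /eqP eb]] _ /negPn/eqP bE]].
  by move: ne; rewrite -bf inE eb bE eqxx orbT.
have [||a [b []]] := connect_exit (P := fun g => ~~ inside p g)
  (sphere_connected (outer G) f).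
- by rewrite negbK connect0.
- by rewrite negbK.
move=> /existsP[e /andP[/eqP ea /eqP eb]] na /negPn ib.
have ep : e \in cycle_edges p.
  apply: contraT => ne; move: ib; rewrite /inside; move: na; rewrite negbK => na.
  move/negP; case; apply: connect_trans na (connect1 _) => /=; apply/existsP; exists e.
  by rewrite ne ea eb !eqxx.
have af : a != f by apply: contraNneq na => ->.
have bE : b = f by move: ep; rewrite -bf inE ea eb (negPf af) => /eqP.
have oep : opp e \in p.
  by move: ep; rewrite inE => /orP[/cw|//]; rewrite ea (negPf na).
have all_f : {in p, forall d, rface d = f}.
  move=> c cp'; apply/eqP.
  apply: (cycle_ind cp (P := fun d => rface d == f)) oep cp' _; last by rewrite eb bE.
  by move=> d' d'p /eqP h; apply/eqP/(cell_next cp bf).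
split; first exact: all_f.
apply: (cycle_ind cp (P := fun d => rface (opp d) != f)) oep dp _; last by rewrite oppK ea.
by move=> d' d'p; apply: contraNneq => h; apply/eqP/(cell_prev cp bf).
Qed.

Lemma Z_arc_rotates M1 M2 : Z_arc M1 M2 -> exists f, rotates f M1 M2.
Proof.
case=> p [[cp [f fo bf]] cw al pr].
have inp d : d \in p -> rface d = f /\ rface (opp d) != f by apply: cell_clockwise.
have pE d : (d \in p) = (rface d == f).
  apply/idP/eqP => [/inp[]//|df]; have := cell_edge bf d.
  by rewrite df eqxx => /orP[//|/inp[_]]; rewrite oppK df eqxx.
move=> /setP D; exists f; split=> // [|d df|d].
- have /andP[] := cp; case: (p) pE => // d q /(_ d); rewrite mem_head => /esym/eqP df _ _.
  by exists d.
- have dp : d \in p by rewrite pE df.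
  apply/idP/idP => [dM|wd]; first by have /allP/(_ d dp)/implyP := pr; apply.
  (* An unmatched dart is followed by a matched one, which leaves a white vertex; so [d] leaves a
     black one. *)
  apply: contraTT wd => dM; have := next_cycle al dp.
  rewrite /= (negPf dM) eq_sym eqbF_neg negbK => nM.
  have := allP pr (next p d); rewrite mem_next => /(_ dp)/implyP/(_ nM).
  by rewrite (cycle_next_src cp) // white_opp.
have nb : ~~ ((d \in p) && (opp d \in p)).
  by apply/negP=> /andP[/inp[_]]; rewrite -pE => /negPf ->.
have := D d; rewrite !inE -!pE; move: nb.
by case: (d \in p); case: (opp d \in p); case: (d \in val M1); case: (d \in val M2).
Qed.

(** With [f] on both sides, [d] and [opp d] would be matched according to opposite colours. *)
Lemma rotates_neq f M1 M2 d : rotates f M1 M2 -> rface d = f -> rface (opp d) != f.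
Proof.
case=> _ _ h _ df; apply/eqP => odf; have := h _ odf.
by rewrite matching_opp white_opp h //; case: (white _).
Qed.

Lemma rotates_inj f M N1 N2 : rotates f M N1 -> rotates f M N2 -> N1 = N2.
Proof.
case=> _ _ _ h1 [_ _ _ h2]; apply/val_inj/setP => d.
by apply: (@addbI (d \in val M)); rewrite h1 h2.
Qed.

(** The change of matching as the coboundary of the indicator of [f], with negative terms moved
    across to stay in the naturals. *)
Lemma rotates_height f M1 M2 d : rotates f M1 M2 -> white (src d) ->
  (d \in val M1) + (rface (opp d) == f) = (d \in val M2) + (rface d == f).
Proof.
move=> r wd; have [_ _ h1 h2] := r; have := h2 d.
case: (rface d =P f) => [df|_].
  by rewrite (negPf (rotates_neq r df)) (h1 _ df) wd; case: (_ \in _).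
case: (rface (opp d) =P f) => [/h1|_]; last by do 2!case: (_ \in _).
by rewrite matching_opp white_opp wd => ->; case: (_ \in _).
Qed.

Lemma Z_arc_neq M N : Z_arc M N -> M <> N.
Proof.
move=> /Z_arc_rotates[f rf] MN; have [_ [d df] _ h] := rf.
by have := h d; rewrite MN addbb df eqxx (negPf (rotates_neq rf df)).
Qed.

Lemma rotates_symdiff f M N d : rotates f M N ->
  (d \in symdiff (val M) (val N)) = (rface d == f) || (rface (opp d) == f).
Proof.
move=> r; have [_ _ _ h] := r; rewrite in_symdiff h.
by case: eqP => [/(rotates_neq r)/negPf->|].
Qed.

Lemma rotates_consecutive f g M M' M'' :
  rotates f M M' -> rotates g M' M'' -> f <> g.
Proof.
move=> r [_ _ h3 _] e; have [_ [d df] h1 h2] := r; have := h2 d.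
by rewrite h1 // h3 ?df // addbb eqxx (negPf (rotates_neq r df)).
Qed.

(* The face function counting, with signs, the rotations along both sides of   *)
(* the square is constant across every edge and vanishes at the outer face.    *)
Lemma rotates_square (a b c e : face G) (M Ma Mb N : matching G) :
    rotates a M Ma -> rotates c Ma N -> rotates b M Mb -> rotates e Mb N ->
  Ma != Mb -> a = e /\ c = b.
Proof.
move=> ra rc rb re nab.
have heq d : (rface (opp d) == a) + (rface (opp d) == c) + ((rface d == b) + (rface d == e))
   = (rface (opp d) == b) + (rface (opp d) == e) + ((rface d == a) + (rface d == c)).
  wlog wd : d / white (src d) => [W|].
    case: (boolP (white (src d))) => [/W //|wd].
    have := W (opp d); rewrite white_opp wd oppK => /(_ isT) e0.
    by rewrite addnC [RHS]addnC e0.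
  have arith (m ma mb n u u' v v' w w' t t' : nat) :
    m + u' = ma + u -> ma + w' = n + w -> m + v' = mb + v -> mb + t' = n + t ->
    u' + w' + (v + t) = v' + t' + (u + w) by lia.
  exact: arith (rotates_height ra wd) (rotates_height rc wd)
    (rotates_height rb wd) (rotates_height re wd).
have hconst g : (g == a) + (g == c) = (g == b) + (g == e).
  have [ao _ _ _] := ra; have [bo _ _ _] := rb; have [co _ _ _] := rc; have [eo _ _ _] := re.
  have /connectP[q] := sphere_connected (outer G) g.
  have : (outer G == a) + (outer G == c) = (outer G == b) + (outer G == e).
    by rewrite ![outer G == _]eq_sym (negPf ao) (negPf bo) (negPf co) (negPf eo).
  elim: q (outer G) => [|h q IH] k hk /=; first by move=> _ ->.
  case/andP=> /existsP[d /andP[/eqP dk /eqP dh]] hq; apply: IH hq.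
  by have := heq d; rewrite dk dh -hk => /addIn.
have ab : a != b.
  by apply: contraNneq nab => eab; rewrite eab in ra; rewrite (rotates_inj ra rb).
(* Evaluation at [a] and at [b], which are distinct, identifies the opposite sides. *)
have := hconst a; have := hconst b; rewrite !eqxx (negPf ab) [b == a]eq_sym (negPf ab).
rewrite [b == c]eq_sym.
by case: (c =P b) => [->|]; case: (a =P e) => [->|]; case: (a == c); case: (b == e).
Qed.

(** Whether a cell can be rotated depends only on the matching along its boundary. *)
Lemma Z_arc_transfer M1 M2 M N : Z_arc M1 M2 ->
    {in symdiff (val M1) (val M2), val M =i val M1} ->
  symdiff (val M) (val N) = symdiff (val M1) (val M2) -> Z_arc M N.
Proof.
case=> p [cc cw al pr D] h D'.
have hp d : d \in p -> (d \in val M) = (d \in val M1).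
  by move=> dp; apply: h; rewrite /symdiff D inE dp.
exists p; split=> //; last by rewrite -D.
  rewrite /alternating (eq_in_cycle (P := [in p])
    (e' := [rel d d' | (d \in val M1) != (d' \in val M1)])) //.
    by move=> d e dp ep /=; rewrite !hp.
by apply/allP => d dp; rewrite hp //; apply: (allP pr).
Qed.

Lemma Z_arc_transfer_ex M1 M2 M :
    {in symdiff (val M1) (val M2), val M =i val M1} ->
  exists N, symdiff (val M) (val N) = symdiff (val M1) (val M2).
Proof.
move=> h; set D := symdiff (val M1) (val M2) in h *.
have DE d : d \in D = (d \in val M1) (+) (d \in val M2) by rewrite in_symdiff.
pose N := symdiff (val M) D.
have pN : perfect_matching setT setT N.
  apply/and3P; split; first exact: subsetT.
    by apply/forall_inP => d; rewrite !in_symdiff !matching_opp.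
  apply/forall_inP => v _.
  have deg (A : {set dart G}) : #|[set d in A | src d == v]| = \sum_(d | src d == v) (d \in A).
    by rewrite -sum1dep_card [RHS]big_mkcond [LHS]big_mkcond; apply: eq_bigr => d _;
      case: (_ \in _); case: (_ == _).
  have deg1 (M' : matching G) : \sum_(d | src d == v) (d \in val M') = 1.
    have /and3P[_ _ /forall_inP/(_ v (in_setT v))/eqP] := valP M'.
    by rewrite deg.
  (* Dart by dart, [M] changes exactly as [M1] does, so the degree at [v] remains one. *)
  have : \sum_(d | src d == v) (d \in N) + \sum_(d | src d == v) (d \in val M1)
     = \sum_(d | src d == v) (d \in val M) + \sum_(d | src d == v) (d \in val M2).
    rewrite -!big_split; apply: eq_bigr => d _ /=; rewrite in_symdiff.
    have := h d; rewrite DE.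
    by case: (d \in val M); case: (d \in val M1); case: (d \in val M2) => //= /(_ isT).
  by rewrite deg !deg1 => e; apply/eqP; lia.
exists (exist _ N pN); apply/setP => d.
by rewrite 2!in_symdiff addbA addbb.
Qed.

Lemma Z_arc_commute M M' M'' : Z_arc M M' -> Z_arc M' M'' ->
    [disjoint symdiff (val M) (val M') & symdiff (val M') (val M'')] ->
  exists N, [/\ Z_arc M N, Z_arc N M'' &
    symdiff (val M) (val N) = symdiff (val M') (val M'')].
Proof.
move=> A1 A2 dis.
have dis1 : {in symdiff (val M') (val M''), val M =i val M'}.
  move=> d dD; have := disjointFl dis dD.
  by rewrite in_symdiff; do 2!case: (_ \in _).
have [N DN] := Z_arc_transfer_ex dis1; exists N; split=> //.
  exact: Z_arc_transfer A2 dis1 DN.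
have NE d : (d \in val N) = (d \in val M) (+) ((d \in val M') (+) (d \in val M'')).
  by rewrite -in_symdiff -DN in_symdiff addbA addbb.
apply: Z_arc_transfer A1 _ _.
  move=> d dD; have := disjointFr dis dD.
  by rewrite NE -in_symdiff => ->; rewrite addbF.
apply/setP => d; rewrite !in_symdiff NE.
by do 3!case: (_ \in _).
Qed.

End Arcs.

(** * Cells attached to the poset elements *)

Section Labels.
Context {disp : Order.disp_t} (P : finPOrderType disp) (G : plane_bigraph).
Variable phi : filters P -> matching G.
Hypothesis phi_bij : bijective phi.
Hypothesis phi_le : forall x y, (x <= y)%O <-> matching_le (phi x) (phi y).
Implicit Types (A B : {set P}) (x y z : P).

Lemma is_filter0 : is_filter (set0 : {set P}).
Proof. by apply/is_filterP => x y; rewrite inE. Qed.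

(** Extends [phi] to all sets; one that is not a filter is treated as the empty filter. *)
Definition psi A : matching G := phi (insubd (Filter is_filter0) A).

Definition addable A x : Prop :=
  [/\ is_filter A, x \notin A & forall y, (x < y)%O -> y \in A].

Lemma addable_filter A x : addable A x -> is_filter (x |: A).
Proof.
case=> /is_filterP fA _ xA; apply/is_filterP => y z /setU1P[->|yA] yz; apply/setU1P.
  by move: yz; rewrite le_eqVlt => /predU1P[<-|/xA]; [left|right].
by right; apply: fA yz.
Qed.

Lemma addableU A x y : addable A x -> addable A y -> x != y -> addable (y |: A) x.
Proof.
move=> ax ay xy; have [_ xA hx] := ax; split; first exact: addable_filter.
  by rewrite !inE negb_or xy.
by move=> z /hx zA; rewrite inE zA orbT.
Qed.

Lemma psi_inj A B : is_filter A -> is_filter B -> psi A = psi B -> A = B.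
Proof.
move=> fA fB /(bij_inj phi_bij) /(congr1 val).
by rewrite /= !insubdK.
Qed.

(** Arcs go down in the lattice, which for reverse inclusion means that the filter grows. *)
Lemma Z_arc_psi A N : is_filter A -> Z_arc (psi A) N ->
  exists B, [/\ is_filter B, N = psi B & A \proper B].
Proof.
have [phi' phiK phi'K] := phi_bij.
move=> fA arc; exists (val (phi' N)).
have NE : N = psi (val (phi' N)) by rewrite /psi valKd phi'K.
split=> //; first exact: valP.
rewrite properEneq; apply/andP; split.
  by apply/eqP=> e; apply: (Z_arc_neq arc); rewrite NE -e.
have : (phi' N <= insubd (Filter is_filter0) A)%O.
  by apply/phi_le; rewrite phi'K; apply: rt_step.
by rewrite /Order.le /= /filter_le /= insubdK.
Qed.

(** A directed path leads from [psi A] to [psi (x |: A)], and the filter after its first arc lies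
    strictly above [A] for inclusion and within [x |: A]. *)
Lemma psi_arc A x : addable A x -> Z_arc (psi A) (psi (x |: A)).
Proof.
move=> ax; have [fA xA _] := ax; have fx := addable_filter ax.
have le : matching_le (psi (x |: A)) (psi A).
  by apply/phi_le; rewrite /Order.le /= /filter_le /= !insubdK // subsetUr.
have leP B : is_filter B -> matching_le (psi (x |: A)) (psi B) -> B \subset x |: A.
  by move=> fB /phi_le; rewrite /Order.le /= /filter_le /= !insubdK.
have [e|[N arc NA]] : psi A = psi (x |: A) \/
    exists2 N, Z_arc (psi A) N & matching_le (psi (x |: A)) N.
  case: (clos_rt_rt1n _ _ _ _ le) => [|N M arc /(clos_rt1n_rt _ _ _ _) NM]; first by left.
  by right; exists N.
  by move: xA; rewrite (psi_inj fA fx e) setU11.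
have [B [fB NE AB]] := Z_arc_psi fA arc; rewrite NE in arc NA.
suff <- : B = x |: A by [].
have Bx := leP _ fB NA; apply/eqP; rewrite eqEsubset Bx subUset (proper_sub AB) andbT sub1set.
case/properP: AB => _ [y yB yA]; have := subsetP Bx y yB.
by rewrite !inE (negPf yA) orbF => /eqP <-.
Qed.

Lemma label_square A x y f g : addable A x -> addable A y -> x != y ->
    rotates f (psi A) (psi (x |: A)) ->
    rotates g (psi (y |: A)) (psi (x |: (y |: A))) -> f = g.
Proof.
move=> ax ay xy rf rg.
have [b rb] := Z_arc_rotates (psi_arc ay).
have yx : y != x by rewrite eq_sym.
have [c] := Z_arc_rotates (psi_arc (addableU ay ax yx)); rewrite setUCA => rc.
suff ne : psi (x |: A) != psi (y |: A) by have [] := rotates_square rf rc rb rg ne.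
apply/eqP => /(psi_inj (addable_filter ax) (addable_filter ay)) /setP/(_ x).
by case: ax => _ /negPf xA _; rewrite !inE eqxx (negPf xy) xA.
Qed.

Definition above x : {set P} := [set y | (x < y)%O].

Lemma addable_above x : addable (above x) x.
Proof.
split=> [||y]; rewrite ?inE ?ltxx //.
by apply/is_filterP => y z; rewrite !inE; apply: lt_le_trans.
Qed.

(** The cell of [x] is read off at [above x]. A larger filter is reduced to it by removing other
    elements one at a time, each removal preserving the cell by [label_square]. *)
Lemma exists_label : exists lab : P -> face G, forall A x, addable A x ->
  rotates (lab x) (psi A) (psi (x |: A)).
Proof.
have [lab rlab] : exists lab : P -> face G,
    forall x, rotates (lab x) (psi (above x)) (psi (x |: above x)).
  apply: (@fin_all_exists _ _ (fun x f => rotates f (psi (above x)) (psi (x |: above x)))).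
  by move=> x; apply/Z_arc_rotates/psi_arc/addable_above.
exists lab => A x; have [n] := ubnP #|A|; elim: n A => // n IH A ltA ax.
have [fA xA hx] := ax; have [eA|] := boolP (A \subset above x).
  suff -> : A = above x by [].
  by apply/eqP; rewrite eqEsubset eA; apply/subsetP => y; rewrite inE => /hx.
case/subsetPn=> z0 z0A z0x.
(* Having the fewest elements below it makes [z] minimal in [A], so that [A :\ z] is a filter. *)
case: (arg_minnP (fun z => #|[set w | (w < z)%O]|)
  (P := [pred z in A | z \notin above x]) (i0 := z0)).
  by rewrite /= z0A.
move=> z /andP[/= zA zx] zmin.
have minz w : w \in A -> (w < z)%O -> False.
  move=> wA wz; have wx : w \notin above x.
    by apply: contraNN zx; rewrite !inE => /lt_trans; apply.
  have := zmin w; rewrite /= wA => /(_ wx); rewrite leqNgt => /negP[].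
  apply: proper_card; apply/properP; split.
    by apply/subsetP => u; rewrite !inE => /lt_trans; apply.
  by exists w; rewrite !inE ?ltxx.
have fA' : is_filter (A :\ z).
  apply/is_filterP => u w; rewrite !inE => /andP[uz uA] uw.
  rewrite (is_filterP _ fA _ _ uA uw) andbT; apply: contraNneq uz => wz.
  by move: uw; rewrite wz le_eqVlt => /predU1P[->|/(minz _ uA)].
have az : addable (A :\ z) z.
  split=> // [|w zw]; first by rewrite !inE eqxx.
  by rewrite !inE (is_filterP _ fA _ _ zA (ltW zw)) andbT gt_eqF.
have ax' : addable (A :\ z) x.
  split=> // [|w xw]; first by rewrite !inE (negPf xA) andbF.
  by rewrite !inE hx // andbT; apply: contraNneq zx => <-; rewrite inE.
have xz : x != z by apply: contraNneq xA => ->.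
have AE : z |: (A :\ z) = A by rewrite setD1K.
have [f rf] := Z_arc_rotates (psi_arc ax).
have rx := IH _ _ ax'; rewrite (label_square ax' az xz (rx _) (g := f)) ?AE //.
by move: ltA; rewrite (cardsD1 z A) zA.
Qed.

Section Adjacency.
Variable lab : P -> face G.
Hypothesis labP : forall A x, addable A x ->
  rotates (lab x) (psi A) (psi (x |: A)).

(** Both elements can be added to the same filter, and equal cells would give equal matchings. *)
Lemma label_incomparable x y : ~~ (x <= y)%O -> ~~ (y <= x)%O -> lab x <> lab y.
Proof.
move=> xy yx e; pose A := above x :|: above y.
have fA : is_filter A.
  apply/is_filterP => u v; rewrite !inE => /orP[] h uv; rewrite (lt_le_trans h uv) ?orbT //.
have ax : addable A x.
  split=> // [|z xz]; last by rewrite !inE xz.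
  by rewrite !inE ltxx /=; apply: contraNN yx => /ltW.
have ay : addable A y.
  split=> // [|z yz]; last by rewrite !inE yz orbT.
  by rewrite !inE ltxx orbF; apply: contraNN xy => /ltW.
have rx := labP ax; rewrite e in rx.
have /setP/(_ x) := psi_inj (addable_filter ax) (addable_filter ay) (rotates_inj rx (labP ay)).
have [_ /negPf xA _] := ax.
rewrite !in_setU1 eqxx xA !orbF => /esym exy.
by move: xy; rewrite (eqP exy) lexx.
Qed.

(** A cell cannot be rotated twice in a row. If the two cells had no common edge, their rotations
    would commute and [x] could be added before [y]. *)
Lemma label_cover x y : (x < y)%O -> (forall z, ~~ (x < z < y)%O) ->
  lab x <> lab y /\ exists2 d, rface d = lab x & rface (opp d) = lab y.
Proof.
move=> xy cov; pose A := above x :\ y.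
have fA : is_filter A.
  apply/is_filterP => u v; rewrite !inE => /andP[uy xu] uv.
  rewrite (lt_le_trans xu uv) andbT; apply: contraNneq uy => vy.
  move: uv; rewrite vy le_eqVlt => /predU1P[->//|uy].
  by have := cov u; rewrite xu uy.
have ay : addable A y.
  split=> // [|z yz]; first by rewrite !inE eqxx.
  by rewrite !inE (lt_trans xy yz) gt_eqF.
have yA : y |: A = above x by rewrite setD1K // inE.
have ax : addable (y |: A) x by rewrite yA; exact: addable_above.
have ry := labP ay; have rx := labP ax.
have ne : lab x <> lab y by apply/nesym; exact: rotates_consecutive ry rx.
split=> //.
have [d /andP[/eqP dx /eqP dy]|nod] :=
  pickP [pred d | (rface d == lab x) && (rface (opp d) == lab y)].
  by exists d.
have dis : [disjoint symdiff (val (psi A)) (val (psi (y |: A)))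
                   & symdiff (val (psi (y |: A))) (val (psi (x |: (y |: A))))].
  apply/pred0P => d /=; rewrite (rotates_symdiff _ ry) (rotates_symdiff _ rx).
  apply/negP => /andP[/orP[]/eqP h /orP[]/eqP k].
  - by apply: ne; rewrite -h -k.
  - by have := nod (opp d); rewrite /= oppK h k !eqxx.
  - by have := nod d; rewrite /= h k !eqxx.
  - by apply: ne; rewrite -h -k.
have [N [aN Na DN]] := Z_arc_commute (psi_arc ay) (psi_arc ax) dis.
have [B [fB NE AB]] := Z_arc_psi fA aN; rewrite NE in aN Na DN.
have [C [fC CE BC]] := Z_arc_psi fB Na.
have {}CE := psi_inj (addable_filter ax) fC CE; rewrite -CE in BC.
(* Otherwise [B] is [y |: A], and the two disjoint flips coincide. *)
have xB : x \in B.
  apply: contraT => xB; have By : B = y |: A.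
    have sB : B \subset y |: A.
      apply/subsetP => z zB; have := subsetP (proper_sub BC) z zB.
      by rewrite in_setU1 => /predU1P[zx|//]; rewrite zx (negPf xB) in zB.
    apply/eqP; rewrite eqEsubset sB subUset (proper_sub AB) andbT sub1set.
    case/properP: AB => _ [z zB zA]; have := subsetP sB z zB.
    by rewrite in_setU1 (negPf zA) orbF => /eqP <-.
  have [_ [d dx] _ _] := rx; move: dis => /pred0P/(_ d) /=.
  by rewrite -DN By (rotates_symdiff _ ry) andbb => h; move: (rotates_symdiff d rx);
    rewrite -DN By (rotates_symdiff _ ry) h dx eqxx.
case/properP: BC => _ [z zC /negP[]].
move: zC; rewrite !in_setU1 => /or3P[/eqP->//|/eqP->|zA].
  exact: (is_filterP _ fB _ _ xB (ltW xy)).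
exact: (subsetP (proper_sub AB)).
Qed.
End Adjacency.

End Labels.

(** * The order of Delta and the injectivity of its labels *)

Section DeltaOrder.
Implicit Types a b : Delta.

Lemma Delta_lt_rank a b : (a < b)%O -> Delta_rank a < Delta_rank b.
Proof. by rewrite lt_def => /andP[ne /Delta_le_rank[e|//]]; rewrite e eqxx in ne. Qed.

Lemma Delta_cover_lt a b : Delta_cover a b -> (a < b)%O.
Proof.
move=> ab; rewrite lt_def (connect1 ab : (a <= b)%O) andbT.
by apply/eqP => e; move: ab; rewrite e; case: (a).
Qed.

Lemma Delta_ltE a b : (a < b)%O -> (b == D0) || Delta_cover a b.
Proof.
rewrite lt_def => /andP[ne /connectP[q]]; elim: q a ne => [|c q IH] a ne /=.
  by move=> _ e; rewrite e eqxx in ne.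
case/andP=> ac cq eb; have [e|nbc] := eqVneq b c; first by rewrite e ac orbT.
case/orP: (IH c nbc cq eb) => [->//|cb].
by move: ac cb; case: (a) (c) (b) => [|i|x] [|j|y] [|k|z].
Qed.

Lemma Delta_no_between a b c : Delta_rank b = (Delta_rank a).+1 -> ~~ (a < c < b)%O.
Proof.
move=> rk; apply/negP => /andP[/Delta_lt_rank ac /Delta_lt_rank cb].
by move: ac cb; rewrite rk; lia.
Qed.
End DeltaOrder.

Section DeltaLabels.
Variables (G : plane_bigraph) (phi : filters Delta -> matching G).
Hypothesis phi_bij : bijective phi.
Hypothesis phi_le : forall x y, (x <= y)%O <-> matching_le (phi x) (phi y).
Variable lab : Delta -> face G.
Hypothesis labP : forall A x, addable A x ->
  rotates (lab x) (psi phi A) (psi phi (x |: A)).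

Lemma adjacent_labels a b : Delta_cover a b ->
  lab a <> lab b /\ exists2 d, rface d = lab a & rface (opp d) = lab b.
Proof.
move=> ab; apply: (label_cover phi_bij phi_le labP (Delta_cover_lt ab)) => c.
by apply: Delta_no_between; case: a b ab => [|i|x] [|j|y].
Qed.

(* A cell rotated at D0 and again at Dx x would have all its edges flipped in  *)
(* between by the two elements above x, yet it has one in common with a third. *)
Lemma label_top_bottom x : lab (Dx x) <> lab D0.
Proof.
move=> e0; pose i := (val x).1; pose j := (val x).2.
have [k /norP[ki kj]] : exists k, ~~ ((k == i) || (k == j)).
  apply/existsP; rewrite -negb_forall; apply/negP => /forallP h.
  have : #|'I_4| <= #|[set i; j]|.
    by apply/subset_leq_card/subsetP => k _; rewrite !inE.
  by rewrite card_ord cards2; case: (_ != _).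
have [d d0 dk] : exists2 d, rface d = lab D0 & rface (opp d) = lab (Di k).
  have [//|_ [d dk d0]] := @adjacent_labels (Di k) D0.
  by exists (opp d); rewrite ?oppK.
have lab_neq l : k != l -> lab (Di l) <> lab (Di k).
  move=> kl; have nle a b : a != b -> ~~ (Di a <= Di b)%O.
    by apply: contraNN => /Delta_le_rank[[->]//|]; rewrite ltnn.
  by apply: (label_incomparable phi_bij labP); apply: nle; rewrite // eq_sym.
(* From the empty filter, 0, i, j and x_ij can be added in this order. *)
have a0 : addable (set0 : {set Delta}) D0.
  split=> [||y /Delta_lt_rank]; rewrite ?inE ?is_filter0 //=; by case: y.
have a1 l : addable (D0 |: set0 : {set Delta}) (Di l).
  split=> [||y /Delta_ltE]; first exact: addable_filter a0.
    by rewrite !inE.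
  by rewrite !inE orbF => /orP[//|]; case: y.
have ij : Di j != Di i :> Delta.
  by rewrite -[_ == _]/(j == i) -val_eqE neq_ltn (valP x) orbT.
have a2 := addableU (a1 j) (a1 i) ij.
have a3 : addable (Di j |: (Di i |: (D0 |: set0))) (Dx x).
  split=> [||y /Delta_ltE]; first exact: addable_filter a2.
    by rewrite !inE.
  rewrite !inE => /orP[->|]; first by rewrite !orbT.
  by case: y => //= l /orP[] /eqP ->; rewrite eqxx ?orbT.
(* The edge of [d] separates the cells of 0 and [k], so rotating the cell of another [l] leaves it
   alone. *)
have same l M N : k != l -> rotates (lab (Di l)) M N -> (d \in val N) = (d \in val M).
  move=> kl [_ _ _ h]; have := h d.
  have [ne _] := @adjacent_labels (Di l) D0 isT.
  have ne' := lab_neq l kl.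
  rewrite d0 dk (introF eqP (nesym ne)) (introF eqP (nesym ne')).
  by do 2!case: (_ \in _).
have r0 := labP a0; have [_ _ h0 h0'] := r0; have [_ _ h3 _] := labP a3.
have := h0' d; rewrite h0 // (negPf (rotates_neq r0 d0)) d0 eqxx /=.
rewrite -(same _ _ _ ki (labP (a1 i))) -(same _ _ _ kj (labP a2)) h3 ?d0 //.
by rewrite addbb.
Qed.

(** Incomparable pairs and covering pairs are settled in general; the other comparable pairs are
    x_ij and 0. *)
Lemma label_inj : injective lab.
Proof.
move=> a b; wlog le : a b / Delta_rank a <= Delta_rank b.
  by move=> W e; case: (leqP (Delta_rank a) (Delta_rank b)) => [|/ltnW] h;
    [|symmetry]; apply: W.
move=> e; have [ab|ab] := boolP (a <= b)%O; last first.
  have [ba|ba] := boolP (b <= a)%O; last by case: (label_incomparable phi_bij labP ab ba).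
  case: (Delta_le_rank ba) => [//|]; lia.
move: ab; rewrite le_eqVlt => /predU1P[//|ab].
have [c1|c1] := eqVneq (Delta_rank b) (Delta_rank a).+1.
  by case: (label_cover phi_bij phi_le labP ab (fun c => Delta_no_between c c1)).
have := Delta_lt_rank ab.
by case: a b c1 e {le ab} => [|i|x] [|k|y] //= _ /label_top_bottom.
Qed.
End DeltaLabels.

Theorem theorem4p4 : ~ matchable (filters Delta).
Proof.
case=> G [_ _ [phi phi_bij phi_le]].
have [lab labP] := exists_label phi_bij phi_le.
have adj := adjacent_labels phi_bij phi_le labP.
have [D rD] : exists D : Delta * Delta -> dart G, forall ab, Delta_cover ab.1 ab.2 ->
    rface (D ab) = lab ab.1 /\ rface (opp (D ab)) = lab ab.2.
  apply: (@fin_all_exists _ _ (fun ab d => Delta_cover ab.1 ab.2 ->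
    rface d = lab ab.1 /\ rface (opp d) = lab ab.2)) => -[a b] /=.
  have [/adj[_ [d da db]]|_] := boolP (Delta_cover a b); first by exists d.
  (* An arbitrary dart serves for pairs that are not covers. *)
  by have [d _] := rface_surj (outer G); exists d.
apply: (@no_K5_in_dual G lab (fun a b => D (a, b))).
- exact: (label_inj phi_bij phi_le labP).
- by move=> a b /(rD (a, b))[].
- by move=> a b /(rD (a, b))[].
Qed.
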